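(* Let $n \ge 2$ and let $A = (a_{ij})$ be a symmetric, nonnegative real $n \times n$ matrix with $a_{ij} \ge 0$ for all $i \neq j$ and $a_{ii} = 0$ for $i = 1, \ldots, n$. Let $A^L$ be the Laplacian associated with $A$, and let $0 = \lambda_1 \le \lambda_2 \le \cdots \le \lambda_n$ be the eigenvalues of $A^L$ (counted with multiplicity). (i) Suppose that, for all indices $i,j,k \in \{1,\ldots,n\}$, $a_{ij} \ge a_{ik}$ if $j < k < i$, and $a_{ij} \le a_{ik}$ if $i < j < k$. Then $A^L$ has an eigenvector $x = (x_1,\ldots,x_n)'$ corresponding to $\lambda_n$ such that $x \perp \mathbf{1}$ and $x_1 \le x_2 \le \cdots \le x_n$. (ii) Suppose that, for all indices $i,j,k \in \{1,\ldots,n\}$, $a_{ij} \le a_{ik}$ if $j < k < i$, and $a_{ij} \ge a_{ik}$ if $i < j < k$. Then $A^L$ has an eigenvector $x = (x_1,\ldots,x_n)'$ corresponding to $\lambda_2$ such that $x \perp \mathbf{1}$ and $x_1 \le x_2 \le \cdots \le x_n$.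
   Context: For a symmetric real $n \times n$ matrix $A = (a_{ij})$, the Laplacian associated with $A$, denoted $A^L$, is the $n \times n$ matrix whose $(i,j)$-element is $-a_{ij}$ if $i \neq j$, and whose $(i,i)$-element is $\sum_{j \neq i} a_{ij}$, $i = 1, \ldots, n$. The vector $\mathbf{1}$ is the all-ones vector in $\mathbb{R}^n$, and $x \perp \mathbf{1}$ means $\sum_{i=1}^n x_i = 0$. Eigenvectors are real and nonzero. *)

(* Defs.v *)
From mathcomp Require Import all_boot all_order all_algebra.
From mathcomp Require Import reals.

Set Implicit Arguments.
Unset Strict Implicit.
Unset Printing Implicit Defensive.

Import Order.TTheory GRing.Theory Num.Theory.
Local Open Scope ring_scope.

Definition laplacian (R : realType) (n : nat) (A : 'M[R]_n) : 'M[R]_n :=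
  \matrix_(i, j) (if i == j then \sum_(k < n | k != i) A i k else - A i j).

(* [lam] lists all the eigenvalues of [M] in nondecreasing order, repeated
   according to algebraic multiplicity.  Indices start at 0, so that the k-th
   smallest eigenvalue is [lam`_k.-1]. *)
Definition sorted_eigenvalues (R : realType) (n : nat) (M : 'M[R]_n)
    (lam : n.-tuple R) : Prop :=
  sorted <=%R lam /\ char_poly M = \prod_(l <- lam) ('X - l%:P).

(* Column eigenvectors, whereas MathComp's [eigenspace] consists of row
   vectors. *)
Definition is_eigenvector (R : realType) (n : nat) (M : 'M[R]_n) (a : R)
    (x : 'cV[R]_n) : Prop :=
  x != 0 /\ M *m x = a *: x.

Definition perp_ones (R : realType) (n : nat) (x : 'cV[R]_n) : Prop :=
  \sum_(i < n) x i 0 = 0.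

Definition nondecreasing_entries (R : realType) (n : nat) (x : 'cV[R]_n) :
    Prop :=
  forall i j : 'I_n, (i <= j)%N -> x i 0 <= x j 0.

(* Main.v *)
(* The difference matrix [D] turns [A^L] into the compression [M = D A^L S],
   where [S] is summation, and [A^L] is similar to a block triangular matrix
   with diagonal blocks [0] and [M].  Monotone vectors orthogonal to the all-ones
   vector correspond to nonnegative vectors, and the hypothesis on [A] makes the
   off-diagonal entries of [M] (case (i)) or [- M] (case (ii)) nonnegative, so
   that Perron's theorem gives a nonnegative eigenvector for the largest
   eigenvalue.

   Perron's theorem for a matrix [B] with nonnegative off-diagonal entries: let
   [t] be the infimum of the [s] such that [s - B] maps some positive vector to
   a positive vector.  For [s > t], [\adj (s - B)] is nonnegative and its
   determinant positive; [t - B] is singular; dividing [\adj (X - B)] by the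
   highest power of [X - t] that divides it and evaluating at [t] gives a
   nonnegative nonzero matrix whose columns are eigenvectors. *)
Require Import Defs.
From mathcomp Require Import all_boot all_order all_algebra.
From mathcomp Require Import classical_sets reals zify lra.

Set Implicit Arguments.
Unset Strict Implicit.

Import Order.TTheory GRing.Theory Num.Theory.
Local Open Scope ring_scope.

(** * Perron's theorem for matrices with nonnegative off-diagonal entries *)

Lemma horner_ge0_closed (R : realFieldType) (p : {poly R}) (t : R) :
  (forall s, t < s -> 0 <= p.[s]) -> 0 <= p.[t].
Proof.
move=> p_ge0; rewrite leNgt; apply/negP => pt_lt0.
have [q pE] : exists q, p - p.[t]%:P = q * ('X - t%:P).
  by apply/factor_theorem; rewrite /root !hornerE subrr.
have {}pE s : p.[s] = p.[t] + q.[s] * (s - t).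
  by have := congr1 (horner^~ s) pE; rewrite !hornerE => <-; lra.
have [ub ubP] := poly_itv_bound q t (t + 1).
have ub_ge0 : 0 <= ub.
  by apply: le_trans (ubP t _); rewrite ?lexx ?lerDl ?ler01.
(* As [c] exceeds the bound [ub] on [q], moving by [h] raises [p] by less than [h * c = - p.[t]].
   The summand [- p.[t]] in [c] keeps [h] at most 1, inside the interval of the bound. *)
pose c := ub + 1 - p.[t]; have c_gt0 : 0 < c by rewrite /c; lra.
pose h := - p.[t] / c.
have h_gt0 : 0 < h by rewrite divr_gt0 ?oppr_gt0.
have hc : h * c = - p.[t] by rewrite mulfVK ?gt_eqF.
have h_le1 : h <= 1 by rewrite ler_pdivrMr // mul1r /c; lra.
have := p_ge0 (t + h); rewrite ltrDl => /(_ h_gt0); rewrite pE.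
have /ubP/ler_normlW : t <= t + h <= t + 1 by rewrite lerDl lerD2l ltW.
rewrite [t + h - t]addrC addKr => qub; apply/negP; rewrite -ltNge.
have : q.[t + h] * h <= ub * h by rewrite ler_pM2r.
have : 0 < h * (1 - p.[t]) by apply: mulr_gt0 => //; lra.
by move: hc; rewrite /c; lra.
Qed.

Definition metzler (R : numDomainType) (m : nat) (B : 'M[R]_m) : Prop :=
  forall i j, i != j -> 0 <= B i j.

(* For [B] with nonnegative off-diagonal entries this says that [t - B] is a
   nonsingular M-matrix. *)
Definition dominates (R : numDomainType) (m : nat) (B : 'M[R]_m) (t : R) :
    Prop :=
  exists x : 'cV[R]_m,
    (forall i, 0 < x i 0) /\ forall i, 0 < ((t%:M - B) *m x) i 0.

Lemma mul_subr_scalar (R : pzRingType) (m : nat) (B : 'M[R]_m) t (x : 'cV_m) i :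
  ((t%:M - B) *m x) i 0 = t * x i 0 - (B *m x) i 0.
Proof. by rewrite mulmxBl mul_scalar_mx !mxE. Qed.

(** Where [x] vanishes only off-diagonal entries of [B] contribute, and they enter with a minus
    sign. *)
Lemma metzler_sub_le0 (R : realFieldType) (m : nat) (B : 'M[R]_m) (t : R)
    (x : 'cV[R]_m) i :
  metzler B -> (forall j, 0 <= x j 0) -> x i 0 = 0 ->
  ((t%:M - B) *m x) i 0 <= 0.
Proof.
move=> B_ge0 x_ge0 xi0; rewrite mul_subr_scalar xi0 mulr0 sub0r oppr_le0 mxE.
apply: sumr_ge0 => j _; have [<-|ij] := eqVneq i j; first by rewrite xi0 mulr0.
by rewrite mulr_ge0 ?B_ge0.
Qed.

Section Dominates.
Variables (R : realFieldType) (m : nat) (B : 'M[R]_m.+1).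
Hypothesis B_ge0 : metzler B.

(** Minimum principle: let [r] be the least ratio of [w] to [x], attained at [i]. Then [w - r x] is
    nonnegative and vanishes at [i], so [t - B] maps it to something nonpositive there; [r < 0]
    would make this value positive. *)
Lemma dominates_monotone t (w : 'cV[R]_m.+1) :
  dominates B t -> (forall i, 0 <= ((t%:M - B) *m w) i 0) ->
  forall i, 0 <= w i 0.
Proof.
move=> [x [x_gt0 Bx_gt0]] Bw_ge0 j.
pose f i := w i 0 / x i 0.
have [i _ fmin] := arg_minP f (erefl : xpredT ord0).
suff r_ge0 : 0 <= f i.
  by have := le_trans r_ge0 (fmin j isT); rewrite /f pmulr_lge0 ?invr_gt0.
rewrite leNgt; apply/negP => r_lt0.
have wE k : (w - f i *: x) k 0 = w k 0 - f i * x k 0 by rewrite !mxE.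
have : ((t%:M - B) *m (w - f i *: x)) i 0 <= 0.
  apply: metzler_sub_le0 => // [k|].
    by rewrite wE subr_ge0 -ler_pdivlMr //; apply: fmin.
  by rewrite wE /f mulfVK ?subrr // gt_eqF.
apply/negP; rewrite -ltNge mulmxBr -scalemxAr mxE [X in _ + X]mxE [X in _ - X]mxE.
by rewrite subr_gt0; apply: lt_le_trans (Bw_ge0 i); rewrite nmulr_rlt0.
Qed.

Lemma dominates_inj t (w : 'cV[R]_m.+1) :
  dominates B t -> (t%:M - B) *m w = 0 -> w = 0.
Proof.
move=> Bt Bw0; apply/colP => i; rewrite [RHS]mxE; apply/eqP; rewrite eq_le.
rewrite -oppr_ge0 (dominates_monotone Bt) ?andbT => [|j]; last by rewrite Bw0 mxE.
have -> : - w i 0 = (- w) i 0 by rewrite [RHS]mxE.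
by apply: (dominates_monotone Bt) => j; rewrite mulmxN Bw0 oppr0 mxE.
Qed.

Lemma dominates_le s t : s <= t -> dominates B s -> dominates B t.
Proof.
move=> le_st [x [x_gt0 Bx_gt0]]; exists x; split=> // i.
apply: lt_le_trans (Bx_gt0 i) _; rewrite !mul_subr_scalar lerB //.
by rewrite ler_pM2r.
Qed.

(** A vector [x] witnesses exactly the [t] above the largest ratio of [B x] to [x]. *)
Lemma dominates_open t : dominates B t -> exists2 s, s < t & dominates B s.
Proof.
move=> [x [x_gt0 Bx_gt0]].
pose f i := (B *m x) i 0 / x i 0.
have [i _ fmax] := arg_maxP f (erefl : xpredT ord0).
have fi_lt : f i < t.
  by rewrite ltr_pdivrMr // -subr_gt0 -mul_subr_scalar.
have [lt_fs lt_st] := midf_lt fi_lt; exists ((f i + t) / 2) => //.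
exists x; split=> // j; rewrite mul_subr_scalar subr_gt0 -ltr_pdivrMr //.
exact: le_lt_trans (fmax j isT) lt_fs.
Qed.

(** Supplies the lower bound that makes the infimum in [perron_metzler] meaningful. *)
Lemma dominates_gt_diag t : dominates B t -> B ord0 ord0 < t.
Proof.
move=> [x [x_gt0 /(_ ord0)]]; rewrite mul_subr_scalar subr_gt0 => Bx_lt.
rewrite -(ltr_pM2r (x_gt0 ord0)); apply: le_lt_trans Bx_lt.
rewrite mxE (bigD1 ord0) //= lerDl sumr_ge0 // => j j_neq0.
by rewrite mulr_ge0 ?B_ge0 1?eq_sym // ltW.
Qed.

Lemma dominates_exists : exists t, dominates B t.
Proof.
pose f i := \sum_j B i j; exists (1 + \sum_i `|f i|).
exists (const_mx 1); split=> i; first by rewrite mxE.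
have Bf : (B *m (const_mx 1 : 'cV_m.+1)) i 0 = f i.
  by rewrite mxE; apply: eq_bigr => j _; rewrite mxE mulr1.
rewrite mul_subr_scalar Bf mxE mulr1 (bigD1 i) //= subr_gt0.
have := ler_norm (f i).
have : 0 <= \sum_(j < m.+1 | j != i) `|f j| by apply: sumr_ge0.
lra.
Qed.

(** [t - B] sends each column of its adjugate to a nonnegative multiple of a basis vector, so the
    minimum principle applies. *)
Lemma dominates_adj_ge0 t :
  dominates B t -> 0 <= \det (t%:M - B) -> forall i j, 0 <= (\adj (t%:M - B)) i j.
Proof.
move=> Bt det_ge0 i j.
have -> : (\adj (t%:M - B)) i j = col j (\adj (t%:M - B)) i 0 by rewrite [RHS]mxE.
apply: (dominates_monotone Bt) => k.
by rewrite colE mulmxA mul_mx_adj -colE 2!mxE mulrn_wge0.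
Qed.

End Dominates.

Lemma horner_char_poly_mx (R : comNzRingType) (m : nat) (B : 'M[R]_m) (t : R) :
  map_mx (horner_eval t) (char_poly_mx B) = t%:M - B.
Proof.
apply/matrixP=> i j; rewrite !mxE /= /horner_eval !hornerE hornerMn hornerX.
by [].
Qed.

Lemma horner_char_poly (R : comNzRingType) (m : nat) (B : 'M[R]_m) (t : R) :
  (char_poly B).[t] = \det (t%:M - B).
Proof.
by rewrite -horner_char_poly_mx -[LHS]/(horner_eval t _) -det_map_mx.
Qed.

(* Dividing [Q] and [g] by powers of [X - t] until [Q] does not vanish at [t]
   leaves a nonzero column of [Q] evaluated at [t] as the eigenvector. *)
Lemma poly_mx_kernel_vector (R : realFieldType) (m : nat) (B : 'M[R]_m) (t : R)
    (Q : 'M[{poly R}]_m) (g : {poly R}) :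
  g != 0 -> \det (t%:M - B) = 0 -> char_poly_mx B *m Q = g%:M ->
  (forall s i j, t < s -> 0 <= (Q i j).[s]) ->
  exists x : 'cV[R]_m, [/\ x != 0, forall i, 0 <= x i 0 & B *m x = t *: x].
Proof.
move=> g_neq0 det0; have [k] := ubnP (size g).
elim: k g g_neq0 Q => // k IHk g g_neq0 Q szg QE Q_ge0.
have QtE : (t%:M - B) *m map_mx (horner_eval t) Q = g.[t]%:M.
  by rewrite -horner_char_poly_mx -map_mxM QE map_scalar_mx.
have gt0 : g.[t] = 0.
  have /eqP := congr1 determinant QtE; rewrite det_mulmx det0 mul0r eq_sym.
  by rewrite det_scalar expf_eq0 => /andP[_ /eqP].
have [Qt0|Qt_neq0] := eqVneq (map_mx (horner_eval t) Q) 0; last first.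
  have [j colj_neq0] : exists j, col j (map_mx (horner_eval t) Q) != 0.
    apply/existsP; apply: contraNT Qt_neq0; rewrite negb_exists => /forallP Q0.
    apply/eqP/matrixP => i j; have /negPn/eqP/colP/(_ i) := Q0 j.
    by rewrite !mxE.
  exists (col j (map_mx (horner_eval t) Q)); split=> // [i|].
    by rewrite !mxE; apply: horner_ge0_closed => s; apply: Q_ge0.
  apply/eqP; rewrite eq_sym -subr_eq0 -mul_scalar_mx -mulmxBl colE mulmxA QtE gt0 -colE.
  by apply/eqP/colP => i; rewrite !mxE mul0rn.
(* Here all entries of [Q], and also [g], are divisible by [X - t]. Cancelling this factor lowers
   the size of [g] and keeps signs to the right of [t]. *)
have dvdE (p : {poly R}) : p.[t] = 0 -> p = (p %/ ('X - t%:P)) * ('X - t%:P).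
  by move=> pt0; rewrite divpK // dvdp_XsubCl /root pt0.
have QdivE : Q = ('X - t%:P) *: map_mx (fun p => p %/ ('X - t%:P)) Q.
  apply/matrixP=> i j; rewrite !mxE mulrC -dvdE //.
  by have /matrixP/(_ i j) := Qt0; rewrite !mxE.
have gdivE := dvdE _ gt0.
apply: (IHk (g %/ ('X - t%:P)) _ (map_mx (fun p => p %/ ('X - t%:P)) Q)).
- by apply: contraNneq g_neq0 => g0; rewrite gdivE g0 mul0r.
- rewrite size_divp ?polyXsubC_eq0 // size_XsubC subn1.
  by rewrite -ltnS prednK // size_poly_gt0.
- apply/matrixP => i j; apply: (mulfI (negbT (polyXsubC_eq0 t))).
  move: QE; rewrite [in X in X -> _]QdivE -scalemxAr [in X in X -> _]gdivE mulrC.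
  by rewrite -scale_scalar_mx => /matrixP/(_ i j); rewrite mxE [in RHS]mxE.
- move=> s i j lt_ts; have := Q_ge0 s i j lt_ts; rewrite [in X in X -> _]QdivE mxE.
  by rewrite hornerM !hornerE pmulr_rge0 ?subr_gt0.
Qed.

Lemma det_eq0_col (F : fieldType) (m : nat) (B : 'M[F]_m) :
  \det B = 0 -> exists2 v : 'cV[F]_m, v != 0 & B *m v = 0.
Proof.
rewrite -det_tr => /eqP/det0P[v v_neq0 vB0]; exists v^T; rewrite ?trmx_eq0 //.
by apply: trmx_inj; rewrite trmx_mul trmxK vB0 trmx0.
Qed.

Lemma perron_metzler (R : realType) (m : nat) (B : 'M[R]_m.+1) :
  metzler B ->
  exists t, exists x : 'cV[R]_m.+1,
    [/\ x != 0, forall i, 0 <= x i 0, B *m x = t *: x,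
        root (char_poly B) t & forall l, root (char_poly B) l -> l <= t].
Proof.
move=> B_ge0; pose G : set R := dominates B.
have [t1 Gt1] := dominates_exists B.
have G_lb : lbound G (B ord0 ord0).
  by move=> s /(dominates_gt_diag B_ge0)/ltW.
have G_neq0 : (G !=set0)%classic by exists t1.
pose t := inf G.
have G_gt s : t < s -> G s.
  by move=> /(inf_lt G_neq0)[r Gr /ltW le_rs]; apply: dominates_le Gr.
have notGt : ~ G t.
  move=> /dominates_open[s lt_st Gs]; have := lt_st; rewrite ltNge => /negP; apply.
  by apply: ge_inf => //; exists (B ord0 ord0).
have det_neq0 s : t < s -> (char_poly B).[s] != 0.
  move=> /G_gt Gs; apply/eqP; rewrite horner_char_poly => /det_eq0_col[v v_neq0].
  by move=> /(dominates_inj B_ge0 Gs)/eqP; rewrite (negPf v_neq0).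
(* A monic polynomial is positive far to the right, so a negative value at [s] would force a root
   beyond [t]. *)
have det_gt0 s : t < s -> 0 < (char_poly B).[s].
  move=> lt_ts; rewrite lt_def det_neq0 //= leNgt; apply/negP => lt0.
  have [b bP] := monic_Cauchy_bound (char_poly_monic B).
  have su : s <= Num.max b s by rewrite le_max lexx orbT.
  have [|r /andP[sr _] /rootP r0] := @poly_ivt _ (char_poly B) _ _ su.
    by rewrite (ltW lt0) ltW // bP // le_max lexx.
  by have := det_neq0 r (lt_le_trans lt_ts sr); rewrite r0 eqxx.
have adj_ge0 s i j : t < s -> 0 <= (\adj (char_poly_mx B) i j).[s].
  move=> lt_ts.
  have -> : (\adj (char_poly_mx B) i j).[s] = \adj (s%:M - B) i j.
    by rewrite -horner_char_poly_mx -map_mx_adj [RHS]mxE.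
  apply: dominates_adj_ge0 => //; first exact: G_gt.
  by rewrite -horner_char_poly ltW ?det_gt0.
(* Otherwise the determinant is positive at [t], and the adjugate applied to the all-ones vector
   witnesses [dominates B t]. Its entries are nonnegative by passing to the limit, and none is zero
   by [metzler_sub_le0]. *)
have det0 : \det (t%:M - B) = 0.
  apply/eqP/negP => /negP det_t_neq0; apply: notGt.
  have det_t_gt0 : 0 < \det (t%:M - B).
    rewrite lt_def det_t_neq0 -horner_char_poly.
    by apply: horner_ge0_closed => s /det_gt0/ltW.
  pose x := \adj (t%:M - B) *m (const_mx 1 : 'cV[R]_m.+1).
  have BxE i : ((t%:M - B) *m x) i 0 = \det (t%:M - B).
    by rewrite mulmxA mul_mx_adj mul_scalar_mx !mxE mulr1.
  have x_ge0 i : 0 <= x i 0.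
    rewrite mxE; apply: sumr_ge0 => j _; rewrite [X in _ * X]mxE mulr1.
    rewrite -horner_char_poly_mx -map_mx_adj [X in 0 <= X]mxE.
    by apply: horner_ge0_closed => s; apply: adj_ge0.
  exists x; split=> i; last by rewrite BxE.
  rewrite lt_def x_ge0 andbT; apply: contraTneq det_t_gt0 => xi0.
  by rewrite -(BxE i) -leNgt metzler_sub_le0.
have [x [x_neq0 x_ge0 BxE]] :=
  poly_mx_kernel_vector (monic_neq0 (char_poly_monic B)) det0
    (mul_mx_adj (char_poly_mx B)) (fun s i j => @adj_ge0 s i j).
exists t, x; split=> //; first by rewrite rootE horner_char_poly det0.
move=> l /rootP l0; rewrite leNgt; apply/negP => /det_neq0.
by rewrite l0 eqxx.
Qed.

(** * Differences, partial sums and compression *)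

Definition diff_mx (R : pzRingType) (m : nat) : 'M[R]_(m, m.+1) :=
  \matrix_(i, j) ((j == lift ord0 i)%:R - (j == widen_ord (leqnSn m) i)%:R).

Definition sum_mx (R : pzRingType) (m : nat) : 'M[R]_(m.+1, m) :=
  \matrix_(i, j) ((j < i)%N : nat)%:R.

Lemma mul_diff_mx (R : pzRingType) (m p : nat) (X : 'M[R]_(m.+1, p)) i k :
  (diff_mx R m *m X) i k = X (lift ord0 i) k - X (widen_ord (leqnSn m) i) k.
Proof.
rewrite mxE; under eq_bigr do rewrite mxE mulrBl !mulr_natl !mulrb.
by rewrite sumrB -!big_mkcond !big_pred1_eq.
Qed.

Lemma diff_sum_mx (R : pzRingType) (m : nat) : diff_mx R m *m sum_mx R m = 1%:M.
Proof.
apply/matrixP => i j; rewrite mul_diff_mx !mxE lift0 ltnS -val_eqE leq_eqVlt /=.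
by case: ltngtP; rewrite /= ?subr0 ?subrr.
Qed.

Lemma diff_mx_const (R : pzRingType) (m : nat) (c : R) :
  diff_mx R m *m const_mx c = 0 :> 'cV_m.
Proof. by apply/matrixP => i j; rewrite mul_diff_mx !mxE subrr. Qed.

Lemma diff_mx_ker (R : pzRingType) (m : nat) (x : 'cV[R]_m.+1) :
  diff_mx R m *m x = 0 -> x = const_mx (x ord0 0).
Proof.
move=> Dx0; apply/colP => -[k lt_km]; rewrite [RHS]mxE.
elim: k lt_km => [|k IHk] lt_km.
  by have -> : Ordinal lt_km = ord0 by apply: val_inj.
pose i : 'I_m := Ordinal (lt_km : (k < m)%N).
have -> : Ordinal lt_km = lift ord0 i by apply: val_inj.
rewrite -(IHk (ltnW lt_km)).
have -> : Ordinal (ltnW lt_km) = widen_ord (leqnSn m) i by apply: val_inj.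
by apply/eqP; rewrite -subr_eq0 -mul_diff_mx Dx0 mxE.
Qed.

Lemma char_poly_conj (R : comNzRingType) (m : nat) (P Q B : 'M[R]_m) :
  P *m Q = 1%:M -> char_poly (P *m B *m Q) = char_poly B.
Proof.
move=> PQ; rewrite /char_poly.
have -> : char_poly_mx (P *m B *m Q) =
    map_mx polyC P *m char_poly_mx B *m map_mx polyC Q.
  have PXQ : map_mx polyC P *m 'X%:M *m map_mx polyC Q = 'X%:M.
    by rewrite scalar_mxC -mulmxA -map_mxM PQ map_mx1 mulmx1.
  by rewrite /char_poly_mx mulmxBr mulmxBl PXQ !map_mxM.
by rewrite !det_mulmx mulrAC -det_mulmx -map_mxM PQ map_mx1 det1 mul1r.
Qed.

(** If [L] kills constants, this is its action on the quotient by constants, in the coordinates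
    given by consecutive differences. *)
Definition diff_conj (R : pzRingType) (m : nat) (L : 'M[R]_m.+1) : 'M[R]_m :=
  diff_mx R m *m L *m sum_mx R m.

(** In the basis formed by the all-ones vector and the columns of [sum_mx], the first column of [L]
    is zero. The dual basis consists of [e0] and the rows of [diff_mx]. *)
Lemma char_poly_diff_conj (R : comNzRingType) (m : nat) (L : 'M[R]_m.+1) :
  L *m (const_mx 1 : 'cV_m.+1) = 0 ->
  char_poly L = 'X * char_poly (diff_conj L).
Proof.
move=> L1.
pose e0 : 'rV[R]_m.+1 := delta_mx 0 0.
pose P : 'M[R]_(1 + m) := col_mx e0 (diff_mx R m).
pose Q : 'M[R]_(1 + m) := row_mx (const_mx 1) (sum_mx R m).
have PQ : P *m Q = 1%:M.
  rewrite mul_col_row diff_sum_mx diff_mx_const -rowE.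
  rewrite scalar_mx_block; congr block_mx.
    by apply/matrixP => i j; rewrite !ord1 !mxE.
  by apply/matrixP => i j; rewrite -rowE !mxE.
rewrite -(char_poly_conj (L : 'M_(1 + m)) PQ).
have -> : P *m (L : 'M_(1 + m)) *m Q =
    block_mx 0 (e0 *m L *m sum_mx R m) 0 (diff_conj L).
  by rewrite mul_col_mx mul_col_row -!(mulmxA _ L (const_mx 1)) L1 !mulmx0.
rewrite /char_poly /char_poly_mx map_block_mx !map_mx0 scalar_mx_block.
rewrite opp_block_mx add_block_mx !(oppr0, addr0, add0r) det_ublock det_scalar.
by rewrite expr1.
Qed.

(** Entry [(i, j)] is the sum over [k > j] of the differences between rows [i + 1] and [i] of [L].
    For [j > i] all terms are nonnegative. For [j < i] the tail is minus the sum over [k <= j],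
    since the whole row of differences sums to 0. *)
Lemma metzler_diff_conj (R : numDomainType) (m : nat) (L : 'M[R]_m.+1) :
  L *m (const_mx 1 : 'cV_m.+1) = 0 ->
  (forall (i : 'I_m) (k : 'I_m.+1), (i.+1 < k)%N ->
     L (widen_ord (leqnSn m) i) k <= L (lift ord0 i) k) ->
  (forall (i : 'I_m) (k : 'I_m.+1), (k < i)%N ->
     L (lift ord0 i) k <= L (widen_ord (leqnSn m) i) k) ->
  metzler (diff_conj L).
Proof.
move=> L1 L_right L_left i j ij.
have conjE : diff_conj L i j =
    \sum_(k < m.+1 | (j < k)%N) (diff_mx R m *m L) i k.
  rewrite mxE [RHS]big_mkcond; apply: eq_bigr => k _.
  by rewrite [X in _ * X]mxE mulr_natr mulrb.
have row0 : \sum_(k < m.+1) (diff_mx R m *m L) i k = 0.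
  have : (diff_mx R m *m L *m (const_mx 1 : 'cV_m.+1)) i 0 = 0.
    by rewrite -mulmxA L1 mulmx0 mxE.
  by rewrite mxE; under eq_bigr do rewrite [X in _ * X]mxE mulr1.
have [lt_ij|lt_ji|/val_inj/eqP] := ltngtP i j; last by rewrite (negPf ij).
  rewrite conjE; apply: sumr_ge0 => k lt_jk.
  by rewrite mul_diff_mx subr_ge0 L_right //; lia.
have -> : diff_conj L i j =
    - \sum_(k < m.+1 | ~~ (j < k)%N) (diff_mx R m *m L) i k.
  apply/eqP; rewrite conjE -addr_eq0; apply/eqP.
  by rewrite -[RHS]row0 [RHS](bigID (fun k : 'I_m.+1 => (j < k)%N)).
rewrite oppr_ge0; apply: sumr_le0 => k le_kj.
by rewrite mul_diff_mx subr_le0 L_left //; lia.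
Qed.

(** * Spectrum and monotone eigenvectors of the Laplacian *)

Lemma laplacian_row_sum (R : realType) (n : nat) (A : 'M[R]_n) :
  laplacian A *m (const_mx 1 : 'cV_n) = 0.
Proof.
apply/colP => i; rewrite mxE [RHS]mxE.
under eq_bigr do rewrite [X in _ * X]mxE mulr1 mxE.
rewrite (bigD1 i) //= eqxx [X in _ + X](eq_bigr (fun k => - A i k)).
  by rewrite sumrN subrr.
by move=> k; rewrite eq_sym => /negPf ->.
Qed.

Lemma laplacian_tr (R : realType) (n : nat) (A : 'M[R]_n) :
  A^T = A -> (laplacian A)^T = laplacian A.
Proof.
move=> A_sym; have A_symE i j : A i j = A j i by rewrite -[in LHS]A_sym mxE.
apply/matrixP => i j; rewrite !mxE eq_sym.
by have [->|_] := eqVneq i j => //; rewrite A_symE.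
Qed.

Lemma laplacian_eigenvalue_ge0 (R : realType) (n : nat) (A : 'M[R]_n) (l : R) :
  A^T = A -> (forall i j, i != j -> 0 <= A i j) ->
  root (char_poly (laplacian A)) l -> 0 <= l.
Proof.
move=> A_sym A_ge0; rewrite -eigenvalue_root_char => /eigenvalueP[v vL v_neq0].
have /existsP[i0 vi0_neq0] : [exists i, v 0 i != 0].
  apply: contraNT v_neq0; rewrite negb_exists => /forallP v0; apply/eqP/rowP => i.
  by rewrite mxE; have /negPn/eqP := v0 i.
(* At an entry of largest modulus, [v_i * (v_i - v_k)] is nonnegative for every [k]. *)
have [i _ vmax] := arg_maxP (fun i => `|v 0 i|) (erefl : xpredT i0).
have vi_gt0 : 0 < `|v 0 i|.
  by apply: lt_le_trans (vmax i0 isT); rewrite normr_gt0.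
have : l * v 0 i = \sum_(k | k != i) A i k * (v 0 i - v 0 k).
  have /rowP/(_ i) := vL; rewrite [RHS]mxE => <-.
  rewrite -[laplacian A]laplacian_tr // mxE (bigD1 i) //= !mxE eqxx mulr_sumr.
  rewrite -big_split /=; apply: eq_bigr => k ki.
  by rewrite !mxE eq_sym (negPf ki); lra.
move=> /(congr1 ( *%R (v 0 i))) lE.
have : 0 <= l * `|v 0 i| ^+ 2.
  rewrite real_normK ?num_real // expr2 mulrCA lE mulr_sumr; apply: sumr_ge0 => k ki.
  rewrite mulrCA mulr_ge0 ?A_ge0 1?eq_sym // mulrBr subr_ge0 -expr2.
  rewrite -(@real_normK _ (v 0 i)) ?num_real // expr2.
  apply: le_trans (ler_norm _) _; rewrite normrM ler_pM2l //; exact: vmax.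
by rewrite pmulr_lge0 // exprn_gt0.
Qed.

Lemma laplacian_monotone_eigenvector (R : realType) (m : nat) (A : 'M[R]_m.+1)
    (l : R) (y : 'cV[R]_m) :
  A^T = A -> y != 0 -> (forall i, 0 <= y i 0) ->
  diff_conj (laplacian A) *m y = l *: y ->
  exists x : 'cV[R]_m.+1,
    [/\ is_eigenvector (laplacian A) l x, perp_ones x & nondecreasing_entries x].
Proof.
move=> A_sym y_neq0 y_ge0 yE.
have L1 := laplacian_row_sum A; have L_tr := laplacian_tr A_sym.
pose one : 'cV[R]_m.+1 := const_mx 1.
pose Sy := sum_mx R m *m y.
(* Subtracting the mean [c] makes the partial sums orthogonal to the all-ones vector without
   changing their differences. *)
pose c := (\sum_i Sy i 0) / m.+1%:R.
pose x := Sy - c *: one.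
have Dx : diff_mx R m *m x = y.
  by rewrite mulmxBr -scalemxAr diff_mx_const scaler0 subr0 mulmxA diff_sum_mx mul1mx.
have xE i : x i 0 = Sy i 0 - c by rewrite !mxE mulr1.
have x_perp : \sum_i x i 0 = 0.
  under eq_bigr do rewrite xE.
  by rewrite sumrB sumr_const card_ord -mulr_natr mulfVK ?pnatr_eq0 ?subrr.
have ones_sum (z : 'cV[R]_m.+1) : (one^T *m z) 0 0 = \sum_i z i 0.
  by rewrite mxE; apply: eq_bigr => i _; rewrite !mxE mul1r.
pose z := laplacian A *m x - l *: x.
(* The defect [z] is constant because its differences vanish, and its entries sum to 0 because
   [laplacian A] is symmetric and kills constants; hence [z = 0]. *)
have Dz : diff_mx R m *m z = 0.
  rewrite mulmxBr -scalemxAr Dx mulmxBr -scalemxAr L1 scaler0 subr0.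
  by rewrite !mulmxA -/(diff_conj _) yE subrr.
have z_sum : \sum_i z i 0 = 0.
  rewrite -ones_sum mulmxBr mulmxA -{1}L_tr -trmx_mul L1 trmx0 mul0mx sub0r.
  by rewrite mxE -scalemxAr mxE ones_sum x_perp mulr0 oppr0.
have z0 : z = 0.
  have [d zE] : exists d, z = const_mx d by exists (z ord0 0); apply: diff_mx_ker.
  suff d0 : d = 0 by rewrite zE d0; apply/colP => i; rewrite !mxE.
  move: z_sum; rewrite zE; under eq_bigr do rewrite mxE.
  by rewrite sumr_const card_ord => /eqP; rewrite mulrn_eq0 => /eqP.
exists x; split=> //.
  split; last by apply/eqP; rewrite -subr_eq0; apply/eqP.
  by apply: contraNneq y_neq0 => x0; rewrite -Dx x0 mulmx0.
move=> i j le_ij; rewrite !xE lerD2r !mxE; apply: ler_sum => k _.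
by rewrite ler_wpM2r // !mxE ler_nat; lia.
Qed.

Lemma root_char_polyN (R : comNzRingType) (m : nat) (B : 'M[R]_m) (l : R) :
  root (char_poly (- B)) (- l) = root (char_poly B) l.
Proof.
rewrite !rootE !horner_char_poly raddfN -opprD -scaleN1r detZ /=.
by rewrite -signr_odd mulr_sign; case: ifP; rewrite ?oppr_eq0.
Qed.

Lemma sorted_nth_bounds (R : numDomainType) (s : seq R) (t : R) :
  sorted <=%R s -> t \in s -> s`_0 <= t <= s`_(size s).-1.
Proof.
move=> s_sorted t_s; have := t_s; rewrite -index_mem => lt_ts.
rewrite -[t in X in X && _](nth_index 0 t_s) -[t in X in _ && X](nth_index 0 t_s).
have s_gt0 := leq_ltn_trans (leq0n _) lt_ts.
by rewrite !(le_sorted_leq_nth 0 s_sorted) ?inE ?prednK // -ltnS prednK.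
Qed.

Unset Implicit Arguments.
Set Strict Implicit.

Theorem theorem7 (R : realType) (n : nat) (hn : (2 <= n)%N) (A : 'M[R]_n)
    (A_sym : A^T = A)
    (A_ge0 : forall i j : 'I_n, i != j -> 0 <= A i j)
    (A_diag : forall i : 'I_n, A i i = 0)
    (lam : n.-tuple R) (lamP : sorted_eigenvalues (laplacian A) lam) :
  [/\ lam`_0 = 0,
      ((forall i j k : 'I_n,
          ((j < k)%N -> (k < i)%N -> A i j >= A i k) /\
          ((i < j)%N -> (j < k)%N -> A i j <= A i k)) ->
       exists x : 'cV[R]_n,
         [/\ is_eigenvector (laplacian A) lam`_n.-1 x,
             perp_ones x & nondecreasing_entries x])
    & ((forall i j k : 'I_n,
          ((j < k)%N -> (k < i)%N -> A i j <= A i k) /\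
          ((i < j)%N -> (j < k)%N -> A i j >= A i k)) ->
       exists x : 'cV[R]_n,
         [/\ is_eigenvector (laplacian A) lam`_1 x,
             perp_ones x & nondecreasing_entries x])].
Proof.
case: n hn A A_sym A_ge0 A_diag lam lamP => [//|[//|m]] _ A A_sym A_ge0 _ lam.
move=> [lam_sorted charE]; pose L := laplacian A; pose M := diff_conj L.
have charL : char_poly L = 'X * char_poly M.
  exact/char_poly_diff_conj/laplacian_row_sum.
have rootL r : root (char_poly L) r = (r \in (lam : seq R)).
  by rewrite charE root_prod_XsubC.
have sz_lam := size_tuple lam.
have lam0 : lam`_0 = 0.
  apply/eqP; rewrite eq_le; apply/andP; split.
    have : 0 \in (lam : seq R) by rewrite -rootL charL rootM rootX eqxx.
    by move=> /(sorted_nth_bounds lam_sorted)/andP[].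
  by apply: (laplacian_eigenvalue_ge0 A_sym A_ge0); rewrite rootL mem_nth ?sz_lam.
(* Dropping one zero from [lam] leaves the sorted eigenvalues of [M], whose first and last are the
   second and last of [lam]. *)
have [s lamE] : exists s, lam = 0 :: s :> seq R.
  by move: lam0 sz_lam; case: (tval lam) => //= r s ->; exists s.
have rootM r : root (char_poly M) r = (r \in s).
  have -> : char_poly M = \prod_(l <- s) ('X - l%:P).
    apply: (mulfI (negbT (polyX_eq0 R))).
    by rewrite -charL charE lamE big_cons polyC0 subr0.
  exact: root_prod_XsubC.
have sz_s : size s = m.+1 by move: sz_lam; rewrite lamE => -[].
have s_sorted : sorted <=%R s by move: lam_sorted; rewrite lamE => /path_sorted.
(* The indices are swapped because [metzler_diff_conj] compares entries within a column, whereas the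
   hypotheses on [A] compare entries within a row. *)
have LE i k : i != k -> L i k = - A k i.
  by move=> ik; rewrite mxE (negPf ik) -[in LHS]A_sym mxE.
split=> // [A_anti|A_rob].
  have M_metzler : metzler M.
    apply: metzler_diff_conj; first exact: laplacian_row_sum.
      move=> i k lt_ik; rewrite !LE -?val_eqE /= /bump; try lia.
      by rewrite lerN2; apply: (A_anti _ _ _).1; rewrite /= /bump; lia.
    move=> i k lt_ki; rewrite !LE -?val_eqE /= /bump; try lia.
    by rewrite lerN2; apply: (A_anti _ _ _).2; rewrite /= /bump; lia.
  have [t [y [y_neq0 y_ge0 yE t_root t_max]]] := perron_metzler M_metzler.
  have -> : lam`_m.+2.-1 = t; last exact: laplacian_monotone_eigenvector yE.
  rewrite lamE /=; apply/eqP; rewrite eq_le t_max ?rootM ?mem_nth ?sz_s //=.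
  have := sorted_nth_bounds s_sorted; rewrite sz_s => /(_ t)/=.
  by rewrite -rootM => /(_ t_root)/andP[].
have M_metzler : metzler (- M).
  rewrite /M /diff_conj -mulNmx -mulmxN; apply: metzler_diff_conj.
  - by rewrite mulNmx laplacian_row_sum oppr0.
  - move=> i k lt_ik; rewrite ![(- L) _ _]mxE !LE -?val_eqE /= /bump; try lia.
    by rewrite !opprK; apply: (A_rob _ _ _).1; rewrite /= /bump; lia.
  - move=> i k lt_ki; rewrite ![(- L) _ _]mxE !LE -?val_eqE /= /bump; try lia.
    by rewrite !opprK; apply: (A_rob _ _ _).2; rewrite /= /bump; lia.
have [t [y [y_neq0 y_ge0 yE t_root t_max]]] := perron_metzler M_metzler.
(* [t] is the largest eigenvalue of [- M], so [- t] is the smallest of [M], the head of [s]. *)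
have -> : lam`_1 = - t.
  rewrite lamE /=; apply/eqP; rewrite eq_le andbC lerNl t_max.
    have : - t \in s by rewrite -rootM -root_char_polyN opprK.
    by move=> /(sorted_nth_bounds s_sorted)/andP[].
  by rewrite root_char_polyN rootM mem_nth ?sz_s.
apply: (laplacian_monotone_eigenvector A_sym y_neq0 y_ge0).
by rewrite scaleNr -yE mulNmx opprK.
Qed.
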